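(* Let $n\ge3$ and $r\ge1$ be integers. Then $$\mathrm{Spec}(A_{n,r})\cap\mathbb Q^\times\neq\emptyset \quad\Longleftrightarrow\quad 1\in\mathrm{Spec}(A_{n,r}) \quad\Longleftrightarrow\quad r\in\{1,10\}.$$
   Context: For integers $n\ge3$ and $r\ge1$, the digraph $\Gamma_{n,r}$ has vertex set $V(\Gamma_{n,r})=\{1,2,\dots,rn-2r+2\}$ and directed edge set $E(\Gamma_{n,r})$ defined by $E(\Gamma_{n,1})=\{(j,j+1):1\le j\le n-1\}\cup\{(n,1)\}$; $E(\Gamma_{n,2})=E(\Gamma_{n,1})\cup\{(1,n+1)\}\cup\{(j,j+1):n+1\le j\le 2n-3\}\cup\{(2n-2,n)\}$; and for $r\ge3$, $E(\Gamma_{n,r})=E(\Gamma_{n,2})\cup\bigcup_{i=1}^{r-2}F_i$, where $F_i=\{(in-2i+2,\,in+n-2i+1)\}\cup\{(j,j+1):in+n-2i+1\le j\le in+2n-2i-3\}\cup\{(in+2n-2i-2,\,in+n-2i)\}$. (For $n=3$ the middle path parts are empty.) The adjacency matrix $A_{n,r}$ is the $(0,1)$-matrix indexed by $V(\Gamma_{n,r})$ whose $(u,v)$-entry is $1$ if and only if $(u,v)\in E(\Gamma_{n,r})$. $\mathrm{Spec}(M)$ denotes the set of complex eigenvalues of a square matrix $M$, and $\mathbb Q^\times$ the set of nonzero rational numbers. *)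

(* Defs.v *)
From mathcomp Require Import all_boot all_order all_algebra.
From mathcomp Require Import classical_sets reals complex.

Set Implicit Arguments.
Unset Strict Implicit.
Unset Printing Implicit Defensive.

Import GRing.Theory.

(* For n >= 3 none of the nat subtractions below truncates. *)

Definition order_Gamma (n r : nat) : nat := r * n - 2 * r + 2.

Definition path_edges (a b : nat) : rel nat :=
  fun u v => [&& a <= u, u <= b & v == u.+1].

Definition single_edge (a b : nat) : rel nat :=
  fun u v => (u == a) && (v == b).

Definition edges_Gamma1 (n : nat) : rel nat := fun u v =>
  path_edges 1 (n - 1) u v || single_edge n 1 u v.

Definition edges_Gamma2 (n : nat) : rel nat := fun u v =>
  [|| edges_Gamma1 n u v, single_edge 1 (n + 1) u v,
      path_edges (n + 1) (2 * n - 3) u v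
    | single_edge (2 * n - 2) n u v].

Definition edges_F (n i : nat) : rel nat := fun u v =>
  [|| single_edge (i * n - 2 * i + 2) (i * n + n - 2 * i + 1) u v,
      path_edges (i * n + n - 2 * i + 1) (i * n + 2 * n - 2 * i - 3) u v
    | single_edge (i * n + 2 * n - 2 * i - 2) (i * n + n - 2 * i) u v].

(* The value at r = 0 is irrelevant. *)
Definition edges_Gamma (n r : nat) : rel nat := fun u v =>
  if r <= 1 then edges_Gamma1 n u v
  else if r == 2 then edges_Gamma2 n u v
  else edges_Gamma2 n u v || has (fun i => edges_F n i u v) (iota 1 (r - 2)).

Local Open Scope ring_scope.
Local Open Scope classical_set_scope.

(* The index i : 'I_(order_Gamma n r) stands for the vertex i + 1. *)
Definition adjacency_mx (K : nzRingType) (n r : nat) : 'M[K]_(order_Gamma n r) :=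
  \matrix_(u, v) (edges_Gamma n r u.+1 v.+1)%:R.

Definition Spec (K : fieldType) (m : nat) (M : 'M[K]_m) : set K :=
  [set a | eigenvalue M a].

Definition nonzero_rationals (K : unitRingType) : set K :=
  [set ratr q | q in [set q : rat | q != 0]].
Arguments nonzero_rationals K : clear implicits.

(* Main.v *)
Require Import Defs.
From mathcomp Require Import all_boot all_order all_algebra.
From mathcomp Require Import zify ring lra.
From mathcomp Require Import classical_sets reals complex.

(** The graph is a chain of [r] directed [n]-cycles, in which consecutive
    cycles share one edge.  Only the vertices at which cycles meet (the joints)
    have more than one entering or leaving edge, so an eigenvector for [a != 0]
    is determined by its values at the joints, up to powers of [a].  After
    removing a further power of [a], these values satisfy
    [P_(k+3) = P_(k+2) - t P_k] with [P_0 = P_1 = P_2 = 1] and [t = a^-n].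
    The chain stops after [r] cycles exactly when [P_(r+2)(t) = 0]; hence [a]
    is an eigenvalue if and only if [P_(r+2)(a^-n) = 0]
    ([eigenvalue_adjacency]).  What remains is to find the zeros of the
    polynomials [P_k] at the inverses of [n]-th powers of rational numbers.

    Let [a] be rational.  Clearing denominators in the recurrence shows that
    the denominator of [a^n] divides a power of its numerator, so [a] is an
    integer.  If [t <= 1/8], then each [P_(k+1)] is at least half of [P_k],
    which keeps [P_k] positive.  As [n >= 3], this excludes [`|a| >= 2], and it
    also excludes [a^n = -1].  Therefore [a^n = 1], so that [1] is an
    eigenvalue as well ([rat_root_chain_poly]).

    At [t = 1] the integers [P_k(1)] are, up to sign and a shift, the Padovan
    numbers at negative indices.  That their only zeros with [k >= 3] are
    [P_3(1)] and [P_12(1)] is a case of the Skolem problem, which is settled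
    59-adically ([padovan_neg_eq0]).  The prime 59 is chosen because the
    sequence has period 58 modulo 59 and each of its zeros modulo 59 lies in the
    class of a true zero.  If [u] is the sequence and [u_m = 0], then
    translation by [58 k] acts as [(1 + 59 B)^k], and the lowest order term of
    [u_(m + 58 k)] is that of [k (u_(m + 58) - u_m)], which is nonzero since
    [59^2] does not divide [u_(m + 58)]. *)

Set Implicit Arguments.
Unset Strict Implicit.
Unset Printing Implicit Defensive.

Import Order.TTheory GRing.Theory Num.Theory.
Local Open Scope ring_scope.

(** * The recurrence of order three with lag *)

Definition lag3 (K : nzRingType) (t x0 x1 x2 : K) (k : nat) : K :=
  (iter k (fun x => (x.1.2, x.2, x.2 - t * x.1.1)) (x0, x1, x2)).1.1.

Lemma lag3S (K : nzRingType) (t x0 x1 x2 : K) k :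
  lag3 t x0 x1 x2 k.+1 = lag3 t x1 x2 (x2 - t * x0) k.
Proof. by rewrite /lag3 iterSr. Qed.

Lemma lag3_rec (K : nzRingType) (t x0 x1 x2 : K) k :
  lag3 t x0 x1 x2 k.+3 = lag3 t x0 x1 x2 k.+2 - t * lag3 t x0 x1 x2 k.
Proof. by rewrite /lag3 !iterS. Qed.

Lemma lag3_rmorph (K L : nzRingType) (h : {rmorphism K -> L}) t x0 x1 x2 k :
  h (lag3 t x0 x1 x2 k) = lag3 (h t) (h x0) (h x1) (h x2) k.
Proof.
elim: k x0 x1 x2 => [//|k IH] x0 x1 x2.
by rewrite !lag3S IH rmorphB rmorphM.
Qed.

Lemma lag3_ind (P : nat -> Prop) :
  P 0%N -> P 1%N -> P 2%N -> (forall k, P k -> P k.+1 -> P k.+2 -> P k.+3) ->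
  forall k, P k.
Proof.
move=> P0 P1 P2 PS k; suff [] : [/\ P k, P k.+1 & P k.+2] by [].
by elim: k => [|k [Q0 Q1 Q2]]; split=> //; apply: PS.
Qed.

Lemma eq_lag3_rec (t : int) (u v : nat -> int) :
  (forall i, u i.+3 = u i.+2 - t * u i) ->
  (forall i, v i.+3 = v i.+2 - t * v i) ->
  u 0%N = v 0%N -> u 1%N = v 1%N -> u 2%N = v 2%N -> u =1 v.
Proof.
move=> uS vS e0 e1 e2; elim/lag3_ind => // k E0 _ E2.
by rewrite uS vS E0 E2.
Qed.

(** * Chain polynomials and the Padovan sequence *)

(** The value of an eigenvector at the joint of index [k], up to a power of the
    eigenvalue [a], as a polynomial in [t = a^-n]. *)
Definition chain_poly (K : nzRingType) (t : K) (k : nat) : K := lag3 t 1 1 1 k.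

Lemma chain_poly_rec (K : nzRingType) (t : K) k :
  chain_poly t k.+3 = chain_poly t k.+2 - t * chain_poly t k.
Proof. exact: lag3_rec. Qed.

(** The sequence [P_k(1)] extended by four terms to negative [k].  The extension
    captures its zeros at [k = -4], [-2], [-1]; the classes of these indices
    modulo 58 contain zeros modulo 59 but no true zero with [k >= 0]. *)
Definition padovan_neg : nat -> int := lag3 1 0 (-1) 0.

Lemma padovan_negD4 k : padovan_neg (k + 4) = chain_poly 1 k.
Proof. by rewrite /padovan_neg addn4 !lag3S; congr lag3. Qed.

(** * p-adic expansion of powers *)

Lemma expr_1D_cubic (A : comNzRingType) (x : A) k :
  exists C, (1 + x) ^+ k = 1 + k%:R * x + 'C(k, 2)%:R * x ^+ 2 + x ^+ 3 * C.
Proof.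
elim: k => [|k [C IH]]; first by exists 0; rewrite expr0 bin0n /= !mulr0n; ring.
exists ((1 + x) * C + 'C(k, 2)%:R).
rewrite exprS IH binS bin1 !natrD; ring.
Qed.

(** The expansion to order three suffices because the quadratic coefficient
    ['C(p, 2)] is divisible by the odd prime [p]; the first order coefficient
    [B] is therefore preserved modulo [p] at each [p]-th power. *)
Lemma expr_odd_prime_lift (A : comNzRingType) (B : A) p s :
  prime p -> odd p ->
  exists C, (1 + p%:R * B) ^+ (p ^ s) = 1 + (p ^ s.+1)%:R * (B + p%:R * C).
Proof.
move=> pP podd; elim: s => [|s [C IH]]; first by exists 0; rewrite mulr0 addr0.
rewrite expnSr exprM IH; set D := B + _.
have [C' ->] := expr_1D_cubic ((p ^ s.+1)%:R * D) p.
have [u ->] : exists u, 'C(p, 2) = (p * u)%N.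
  by exists p.-1./2; rewrite bin2odd.
exists (C + (p ^ s)%:R * (u%:R * D ^+ 2 + (p ^ s)%:R * D ^+ 3 * C')).
rewrite /D !expnS !natrM; ring.
Qed.

(** The first order term of the expansion dominates [p]-adically, for every
    exponent: with [k = p ^ s * l] and [l] prime to [p], the remainder is
    divisible by one more power of [p] than [k * p]. *)
Lemma expr_odd_prime (A : comNzRingType) (B : A) p k :
  prime p -> odd p -> (0 < k)%N ->
  exists s l C, ~~ (p %| l)%N /\
    (1 + p%:R * B) ^+ k = 1 + (p ^ s.+1)%:R * (l%:R * B + p%:R * C).
Proof.
move=> pP podd k0; have p1 := prime_gt1 pP.
have [s [l pl ->]] : exists s, exists2 l, ~~ (p %| l)%N & k = (p ^ s * l)%N.
  exists (logn p k); have [l pl kE] := pfactor_coprime pP k0.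
  by exists l; [rewrite -prime_coprime | rewrite mulnC].
have [C E] := expr_odd_prime_lift B s pP podd; set D := B + _ in E.
have [C' E'] := expr_1D_cubic ((p ^ s.+1)%:R * D) l.
exists s, l, (l%:R * C + (p ^ s)%:R * ('C(l, 2)%:R * D ^+ 2
  + (p ^ s.+1)%:R * D ^+ 3 * C')); split=> //.
rewrite exprM E E' /D !expnS !natrM; ring.
Qed.

(** * Polynomials in the shift operator *)

(** The value at index [0] of [q(S) u], where [S] is the shift operator on
    sequences.  Working in the commutative ring [{poly int}] replaces powers of
    the companion matrix of a recurrence. *)
Definition shift_eval (u : nat -> int) (q : {poly int}) : int :=
  \sum_(i < size q) q`_i * u i.

Lemma shift_eval_widen u (q : {poly int}) n : (size q <= n)%N ->
  shift_eval u q = \sum_(i < n) q`_i * u i.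
Proof.
move=> qn; rewrite /shift_eval (big_ord_widen n (fun i => q`_i * u i)) //.
rewrite big_mkcond; apply: eq_bigr => i _.
by case: ltnP => // ?; rewrite nth_default // mul0r.
Qed.

Lemma shift_evalD u q1 q2 :
  shift_eval u (q1 + q2) = shift_eval u q1 + shift_eval u q2.
Proof.
pose n := maxn (size q1) (size q2).
rewrite !(@shift_eval_widen _ _ n) ?leq_maxl ?leq_maxr ?size_polyD //.
by rewrite -big_split; apply: eq_bigr => i _; rewrite coefD mulrDl.
Qed.

Lemma shift_evalC u c q : shift_eval u (c%:P * q) = c * shift_eval u q.
Proof.
rewrite mul_polyC (@shift_eval_widen _ _ (size q)) ?size_scale_leq //.
by rewrite mulr_sumr; apply: eq_bigr => i _; rewrite coefZ mulrA.
Qed.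

Lemma shift_eval1 u : shift_eval u 1 = u 0%N.
Proof. by rewrite /shift_eval size_poly1 big_ord1 coefC mul1r. Qed.

Lemma shift_evalMX u q :
  shift_eval u (q * 'X) = shift_eval (fun i => u i.+1) q.
Proof.
rewrite (@shift_eval_widen _ _ (size q).+1); last first.
  by have [->|q0] := eqVneq q 0; [rewrite mul0r size_poly0 | rewrite size_mulX].
rewrite big_ord_recl coefMX mul0r add0r.
by apply: eq_bigr => i _; rewrite coefMX.
Qed.

Lemma shift_evalMXn u q n :
  shift_eval u (q * 'X^n) = shift_eval (fun i => u (i + n)%N) q.
Proof.
elim: n u => [|n IH] u; last first.
  by rewrite exprSr mulrA shift_evalMX IH; apply: eq_bigr => i _; rewrite addnS.
by rewrite mulr1; apply: eq_bigr => i _; rewrite addn0.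
Qed.

Lemma shift_evalXn u n : shift_eval u 'X^n = u n.
Proof. by rewrite -['X^n]mul1r shift_evalMXn shift_eval1. Qed.

(** If the [L]-th power of the shift agrees with [1 + p B] on the translates of
    [u], then it can be replaced by [1 + p B] inside every polynomial, hence
    also raised to the power [k]. *)
Lemma shift_eval_period u L p (B : {poly int}) :
  (forall i, u (i + L)%N = shift_eval (fun j => u (j + i)%N) (1 + p%:R * B)) ->
  forall k, u (k * L)%N = shift_eval u ((1 + p%:R * B) ^+ k).
Proof.
move=> uL; set Q := 1 + _ in uL *.
have uLq q : shift_eval u (q * 'X^L) = shift_eval u (q * Q).
  transitivity (shift_eval u (\sum_(i < size q) (q`_i)%:P * (Q * 'X^i))).
    rewrite shift_evalMXn (big_morph _ (shift_evalD u) (id1 := 0)); last first.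
      by rewrite /shift_eval size_poly0 big_ord0.
    by apply: eq_bigr => i _; rewrite shift_evalC shift_evalMXn uL.
  congr shift_eval; rewrite -[in RHS](coefK q) poly_def mulr_suml.
  by apply: eq_bigr => i _; rewrite -mul_polyC mulrA mulrAC.
move=> k; transitivity (shift_eval u ('X^L ^+ k)).
  by rewrite -exprM mulnC shift_evalXn.
rewrite -['X^L ^+ k]mul1r -[in RHS](mul1r (Q ^+ k)); elim: k 1 => [//|k IH] q.
by rewrite !exprSr mulrA uLq mulrAC IH mulrA mulrAC.
Qed.

(** Skolem's method at a zero of [u]: since [u 0 = 0], the leading [p]-adic
    part of [u (k * L)] is that of [k * u L], so that a simple zero modulo
    [p ^ 2] stays isolated in its class. *)
Lemma nonzero_of_lift u L p (B : {poly int}) k :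
  prime p -> odd p -> u 0%N = 0 ->
  (forall i, u (i + L)%N = shift_eval (fun j => u (j + i)%N) (1 + p%:R * B)) ->
  ~~ (p%:Z ^+ 2 %| u L)%Z -> (0 < k)%N -> u (k * L)%N != 0.
Proof.
move=> pP podd u0 uL pu k0; rewrite (shift_eval_period uL).
have [s [l [C [pl ->]]]] := expr_odd_prime B pP podd k0.
have uB : u L = p%:R * shift_eval u B.
  have -> : u L = shift_eval u (1 + p%:R * B).
    by rewrite -[L]add0n uL; apply: eq_bigr => i _; rewrite addn0.
  by rewrite shift_evalD shift_eval1 u0 add0r -polyC_natr shift_evalC.
have {pu uB} pB : ~~ (p%:Z %| shift_eval u B)%Z.
  apply: contra pu; rewrite uB expr2 natz; exact: dvdz_mul.
rewrite shift_evalD shift_eval1 u0 add0r -polyC_natr shift_evalC mulf_neq0 //.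
  by rewrite pnatr_eq0 -lt0n expn_gt0 prime_gt0.
rewrite shift_evalD -!polyC_natr !shift_evalC.
apply: contra pB => /eqP /(canRL (addrK _)) E; move: E; rewrite sub0r => E.
have : (p%:Z %| l%:R * shift_eval u B)%Z.
  by rewrite E -mulrN natz dvdz_mulr.
by rewrite natz Gauss_dvdzr // coprimezE /= prime_coprime.
Qed.

Lemma shift_eval_rec t x0 x1 x2 (q : {poly int}) k (u := lag3 t x0 x1 x2) :
  shift_eval (fun j => u (j + k.+3)%N) q
  = shift_eval (fun j => u (j + k.+2)%N) q
    - t * shift_eval (fun j => u (j + k)%N) q.
Proof.
rewrite /shift_eval mulr_sumr -sumrB; apply: eq_bigr => i _.
rewrite /u !addnS lag3_rec; ring.
Qed.

(** * Zeros of the Padovan sequence at negative indices *)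

Lemma padovan_neg_period : exists B : {poly int}, forall i,
  padovan_neg (i + 58) =
    shift_eval (fun j => padovan_neg (j + i)) (1 + 59%:R * B).
Proof.
(* The initial values (0, -1, 0) and the two shifted triples form a signed
   permutation matrix, so the coefficients of B are, up to sign and order, the
   quotients by 59 of u_58 - u_0, u_59 - u_1 and u_60 - u_2. *)
exists ((-35)%:P * 'X^0 + (-32)%:P * 'X^1 + 19%:P * 'X^2).
apply: (@eq_lag3_rec 1) => [i|i|||].
- by rewrite !addSn /padovan_neg lag3_rec.
- by rewrite shift_eval_rec.
all: rewrite -polyC_natr !shift_evalD !shift_evalC !shift_evalD !shift_evalC.
all: by rewrite !shift_evalXn; vm_compute.
Qed.

Lemma padovan_neg_eq0 i :
  (padovan_neg i == 0) = (i \in [:: 0; 2; 3; 7; 16]%N).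
Proof.
apply/idP/idP; last by rewrite !inE => /or4P[||| /orP[]] /eqP->; vm_compute.
have [B cB] := padovan_neg_period.
have c59 k m : (padovan_neg (k * 58 + m) = padovan_neg m %[mod 59])%Z.
  elim: k => [|k <-]; first by rewrite add0n.
  rewrite mulSn -addnA addnC cB shift_evalD shift_eval1 add0n.
  by rewrite -polyC_natr shift_evalC natz addrC mulrC modzMDl.
rewrite (divn_eq i 58); set k := (i %/ 58)%N; set m := (i %% 58)%N => ci0.
have m58 : (m < 58)%N by rewrite ltn_mod.
(* Modulo 59 every zero in the period lies in the class of a true zero. *)
have m_zero : m \in [:: 0; 2; 3; 7; 16]%N.
  have /allP : all (fun j => (59%:Z %| padovan_neg j)%Z ==>
      (j \in [:: 0; 2; 3; 7; 16]%N)) (iota 0 58) by vm_compute.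
  move=> /(_ m); rewrite mem_iota m58 => /(_ isT) /implyP; apply.
  by apply/dvdz_mod0P; rewrite -(c59 k) (eqP ci0) mod0z.
have [->|k0] := posnP k; first by [].
(* No further multiple of the period reaches zero from a true zero. *)
have : padovan_neg (k * 58 + m) != 0; last by rewrite ci0.
have /andP[cm pcm] : (padovan_neg m == 0) &&
    ~~ (59%:Z ^+ 2 %| padovan_neg (58 + m))%Z.
  by move: m_zero; rewrite !inE => /or4P[||| /orP[]] /eqP->; vm_compute.
apply: (@nonzero_of_lift (fun j => padovan_neg (j + m)) 58 59 B) => //.
- exact/eqP.
- move=> j; rewrite addnAC cB; apply: eq_bigr => l _.
  by rewrite addnA.
Qed.

Lemma chain_poly1_eq0 k : (3 <= k)%N ->
  (chain_poly (1 : int) k == 0) = (k == 3) || (k == 12).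
Proof. by move=> k3; rewrite -padovan_negD4 padovan_neg_eq0 !inE; lia. Qed.

(** * Rational roots of the chain polynomials *)

(** The bound [1/8] is where the induction closes: if each term is at least half
    of its predecessor and [t >= 0], then [t * P_k <= 4 t * P_(k+2)], where
    [1 - 4 t >= 1/2]; for [t < 0] the terms do not decrease. *)
Lemma chain_poly_gt0 (F : realFieldType) (t : F) k :
  t <= 8^-1 -> 0 < chain_poly t k.
Proof.
move=> t8; suff [] : [/\ 0 < chain_poly t k,
    chain_poly t k <= 2 * chain_poly t k.+1
    & chain_poly t k.+1 <= 2 * chain_poly t k.+2] by [].
elim: k => [|k [p0 p1 p2]]; first by rewrite /chain_poly /lag3 /=; split; lra.
rewrite chain_poly_rec; split=> //; first by lra.
nra.
Qed.

(** Homogenizing with [a ^ k] makes [P_k(b / a)] an integer in which every term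
    but the first carries a factor [b]; this is the rational root theorem for
    the reciprocal of [P_k], whose leading coefficient is [1]. *)
Lemma chain_poly_mod (a b : int) k : a != 0 ->
  exists z : int, a%:~R ^+ k * chain_poly (b%:~R / a%:~R) k
                  = (a ^+ k + b * z)%:~R :> rat.
Proof.
move=> a0; have a0' : a%:~R != 0 :> rat by rewrite intr_eq0.
elim/lag3_ind: k => [||| k [z0 E0] _ [z2 E2]].
1-3: by exists 0; rewrite /chain_poly /lag3 /= mulr1 mulr0 addr0 rmorphXn.
exists (a * z2 - a ^+ 2 * (a ^+ k + b * z0)).
have -> : (a ^+ k.+3 + b * (a * z2 - a ^+ 2 * (a ^+ k + b * z0)))
  = a * (a ^+ k.+2 + b * z2) - b * a ^+ 2 * (a ^+ k + b * z0).
  by rewrite !exprS; ring.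
rewrite rmorphB !rmorphM /= -E0 -E2 chain_poly_rec !exprS; field.
exact: a0'.
Qed.

Lemma rat_root_chain_poly (q : rat) n k : q != 0 -> (3 <= n)%N ->
  chain_poly (q ^- n) k = 0 -> q ^+ n = 1.
Proof.
move=> q0 n3 root_q; set a := numq q; set b := denq q.
have a0 : a != 0 by rewrite numq_eq0.
have qE : q = a%:~R / b%:~R by rewrite divq_num_den.
have qnE : q ^- n = (b ^+ n)%:~R / (a ^+ n)%:~R.
  by rewrite qE expr_div_n invf_div !rmorphXn.
(* At a root, b divides a power of a, which is prime to b. *)
have b1 : b = 1.
  have [|z] := @chain_poly_mod (a ^+ n) (b ^+ n) k; first by rewrite expf_neq0.
  rewrite -qnE root_q mulr0 => /esym/eqP.
  rewrite intr_eq0 addr_eq0 -mulrN => /eqP E.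
  have cop : coprimez b (a ^+ n ^+ k).
    by rewrite -exprM coprimezXr // coprimez_sym coprimezE coprime_num_den.
  have : (b %| a ^+ n ^+ k)%Z.
    by rewrite E dvdz_mulr // -[n]prednK ?exprS ?dvdz_mulr //; lia.
  move=> /dvdzP [c ac]; move: cop; rewrite ac coprimezMr => /andP[_].
  rewrite coprimezE /coprime gcdnn => /eqP; have := denq_gt0 q; rewrite -/b; lia.
rewrite {}qE b1 divr1 in root_q *; rewrite -rmorphXn.
have [a1|a1] := leqP `|a| 1; last first.
  have: 0 < chain_poly ((a%:~R : rat) ^- n) k; last by rewrite root_q ltxx.
  apply: chain_poly_gt0.
  apply: le_trans (ler_norm _) _.
  rewrite normfV normrX lef_pV2 ?posrE ?exprn_gt0 ?normr_gt0 ?intr_eq0 //.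
  have : 2 <= `|a%:~R : rat| by rewrite -intr_norm (ler_int _ 2); lia.
  move=> a2; apply: (@le_trans _ _ (2 ^+ n)); last by rewrite lerXn2r ?nnegrE.
  have -> : 8 = 2 ^+ 3 :> rat by [].
  by rewrite ler_eXn2l.
have [->|aN1] : a = 1 \/ a = -1 by lia.
  by rewrite expr1n.
have [-> //|aE] : a ^+ n = 1 \/ a ^+ n = -1.
  by rewrite aN1 -signr_odd; case: odd; [right | left].
have: 0 < chain_poly ((a%:~R : rat) ^- n) k; last by rewrite root_q ltxx.
by apply: chain_poly_gt0; rewrite -rmorphXn aE.
Qed.

(** * The graph as a chain of cycles *)

(** With [n = m + 2], consecutive cycles share the edges [joint k.+1 -> joint k]
    for [1 <= k < r].  Regarding vertex [2] as the joint of index [0], before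
    vertex [1], makes the first cycle look like all others. *)
Definition joint (m k : nat) : nat :=
  if k is k'.+1 then if k' is k''.+1 then (k * m - m + 2)%N else 1%N else 2%N.

Lemma jointSS m k : joint m k.+2 = (k.+1 * m + 2)%N.
Proof. by rewrite /joint mulSn addKn. Qed.

(** The [k]-th cycle: it leaves [joint k], runs through the [m] new vertices
    [k * m + 3, ..., k * m + m + 2], the last of which is [joint k.+2], and
    reaches [joint k.+1].  Its closing edge [joint k.+1 -> joint k] belongs to
    the previous block, or is [1 -> 2]. *)
Definition block_edges (m k : nat) : rel nat := fun u v =>
  [|| single_edge (joint m k) (k * m + 3)%N u v,
      path_edges (k * m + 3) (k * m + m + 1) u v
    | single_edge (joint m k.+2) (joint m k.+1) u v].

Lemma edges_Gamma1_block m u v : (0 < m)%N ->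
  edges_Gamma1 m.+2 u v = single_edge 1 2 u v || block_edges m 0 u v.
Proof.
move=> m0; rewrite /edges_Gamma1 /block_edges /single_edge /path_edges jointSS /=.
rewrite mul0n mul1n !add0n subn1 /=.
have [->|vu] := eqVneq v u.+1; last by rewrite !andbF /=; lia.
rewrite !andbT !eqSS; lia.
Qed.

Lemma edges_F_block m i u v :
  edges_F m.+2 i.+1 u v = block_edges m i.+2 u v.
Proof.
rewrite /edges_F /block_edges !jointSS.
by congr [|| single_edge _ _ u v, path_edges _ _ u v | single_edge _ _ u v]; lia.
Qed.

Lemma edges_Gamma2_block m u v : (0 < m)%N ->
  edges_Gamma2 m.+2 u v
  = [|| single_edge 1 2 u v, block_edges m 0 u v | block_edges m 1 u v].
Proof.
move=> m0; rewrite /edges_Gamma2 edges_Gamma1_block // [RHS]orbA; congr (_ || _).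
rewrite [RHS]/block_edges !jointSS.
by congr [|| single_edge _ _ u v, path_edges _ _ u v | single_edge _ _ u v]; lia.
Qed.

Lemma edges_GammaE m r u v : (0 < m)%N -> (0 < r)%N ->
  edges_Gamma m.+2 r u v
    = single_edge 1 2 u v || has (fun k => block_edges m k u v) (iota 0 r).
Proof.
move=> m0; case: r => [//|[|[|r]]] _; rewrite /edges_Gamma.
- by rewrite edges_Gamma1_block //= orbF.
- by rewrite edges_Gamma2_block //= orbF.
have -> : iota 1 (r.+3 - 2) = map (addn 1) (iota 0 r.+1).
  by rewrite -iotaDl subn2.
have -> : iota 0 r.+3 = [:: 0, 1 & map (addn 2) (iota 0 r.+1)]%N.
  by rewrite -iotaDl.
move: (iota 0 r.+1) => s; rewrite edges_Gamma2_block // /=.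
case: (single_edge _ _ _ _); case: (block_edges m 0 u v) => //.
case: (block_edges m 1 u v) => //=.
by rewrite !has_map; apply: eq_has => i; rewrite /= edges_F_block.
Qed.

Lemma joint_lt m k : (0 < m)%N -> (joint m k < k * m + 3)%N.
Proof.
case: k => [|[|k]] m0; rewrite ?jointSS /joint; last rewrite !mulSn; lia.
Qed.

Lemma edges_Gamma_to1 m r u : (0 < m)%N -> (0 < r)%N ->
  edges_Gamma m.+2 r u 1 = (u == joint m 2).
Proof.
move=> m0 r0; rewrite edges_GammaE // {1}/single_edge andbF /=.
apply/hasP/eqP => [[k _]|->]; last first.
  by exists 0%N; rewrite ?mem_iota // /block_edges /single_edge !eqxx !orbT.
rewrite /block_edges /single_edge /path_edges.
case: k => [|k]; last by rewrite [joint m k.+2]jointSS /=; lia.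
rewrite /=; lia.
Qed.

Lemma edges_Gamma_to2 m r u : (0 < m)%N -> (0 < r)%N ->
  edges_Gamma m.+2 r u 2 = (u == 1)%N.
Proof.
move=> m0 r0; rewrite edges_GammaE // /single_edge andbT.
case: eqP => //= u1; apply/hasP => -[k _].
rewrite /block_edges /single_edge /path_edges.
case: k => [|k]; last by rewrite [joint m k.+2]jointSS /=; lia.
rewrite /=; lia.
Qed.

(** Besides its predecessor on the path, only the last vertex of a block, which
    is [joint k.+2], has a second entering edge, from the following joint. *)
Lemma edges_Gamma_to_block m r k j u : (0 < m)%N -> (k < r)%N -> (j < m)%N ->
  edges_Gamma m.+2 r u (k * m + 3 + j)%N =
  ((u == if j == 0 then joint m k else k * m + 2 + j)
    || [&& j.+1 == m, k.+1 < r & u == joint m k.+3])%N.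
Proof.
move=> m0 kr jm; rewrite edges_GammaE //; last lia.
rewrite {1}/single_edge [_ == 2%N]gtn_eqF ?andbF ?orFb; last lia.
apply/hasP/idP.
  move=> [ i ]; rewrite mem_iota add0n /= => ir.
  rewrite /block_edges => /or3P[||].
  - rewrite /single_edge => /andP[/eqP-> /eqP E].
    have ik : i = k by nia.
    rewrite ik in E *; have -> : j = 0%N by lia.
    by rewrite /= eqxx.
  - rewrite /path_edges => /and3P[u1 u2 /eqP E].
    have ik : i = k by nia.
    rewrite ik in u1 u2 E; have -> : (j == 0%N) = false by lia.
    apply/orP; left; lia.
  case: i ir => [|i] ir; rewrite /single_edge; first by case/andP=> _ /eqP /=; lia.
  rewrite [joint m i.+2]jointSS => /andP[/eqP-> /eqP E].
  have ik : i = k by nia.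
  rewrite ik in ir E *.
  have -> : j.+1 == m by lia. by rewrite ir eqxx orbT.
move=> /orP[/eqP|/and3P[/eqP jm1 k1 /eqP->]]; last first.
  exists k.+1; first by rewrite mem_iota.
  rewrite /block_edges /single_edge eqxx [joint m k.+2]jointSS.
  by apply/or3P/Or33; rewrite -jm1; apply/eqP; lia.
case: j jm => [|j] jm ->; exists k; rewrite ?mem_iota //.
  by rewrite !addn0 /block_edges /single_edge !eqxx.
by apply/or3P/Or32; rewrite /path_edges /=; lia.
Qed.

(** * The eigenvector equations *)

(** Eigenvectors as functions on the positive integers, so that vertices can be
    computed with as numbers instead of elements of an ordinal type. *)
Lemma eigenvalue_relP (K : fieldType) (e : rel nat) N (a : K) :
  eigenvalue (\matrix_(u < N, v < N) (e u.+1 v.+1)%:R) a <->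
  exists f : nat -> K, (exists2 w, (0 < w <= N)%N & f w != 0) /\
    forall w, (0 < w <= N)%N -> \sum_(1 <= u < N.+1 | e u w) f u = a * f w.
Proof.
have sumE (f : nat -> K) (v : 'rV[K]_N) (j : 'I_N) :
    (forall i : 'I_N, f i.+1 = v 0 i) ->
    \sum_(1 <= u < N.+1 | e u j.+1) f u
    = (v *m \matrix_(u < N, v < N) (e u.+1 v.+1)%:R) 0 j.
  move=> fv; rewrite big_add1 big_mkord big_mkcond mxE; apply: eq_bigr => i _.
  by rewrite !mxE fv mulr_natr; case: e.
split=> [/eigenvalueP[v vA v0] | [f [[w wN fw] fA]]].
  pose f w := if insub w.-1 is Some i then v 0 i else 0.
  have fv (i : 'I_N) : f i.+1 = v 0 i by rewrite /f /= valK.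
  exists f; split=> [|[//|w] wN].
    have /rV0Pn[i vi] := v0.
    by exists i.+1; rewrite ?fv //; case: i {vi}.
  by rewrite -[w]/(val (Ordinal wN)) (sumE f v) // vA mxE fv.
pose v := \row_(i < N) f i.+1.
apply/eigenvalueP; exists v.
  apply/rowP => j; rewrite -(sumE f) => [|i]; last by rewrite mxE.
  by rewrite fA ?mxE //; case: j.
case: w wN fw => // w wN fw; apply/rV0Pn.
by exists (Ordinal wN); rewrite mxE.
Qed.

Lemma sum_pred2_nat (V : zmodType) (f : nat -> V) (b : bool) x y N :
  (0 < x <= N)%N -> (b -> (0 < y <= N)%N /\ x != y) ->
  \sum_(1 <= u < N.+1 | (u == x) || b && (u == y)) f u
  = f x + (if b then f y else 0).
Proof.
move=> xN byN.
have sum1 z : (0 < z <= N)%N -> \sum_(1 <= u < N.+1 | u == z) f u = f z.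
  by move=> zN; rewrite big_nat1_eq ltnS zN.
case: b byN => [/(_ isT)[yN xy]|_]; last first.
  by rewrite addr0 -[RHS]sum1 //; under eq_bigl do rewrite orbF.
rewrite -(sum1 x) // -(sum1 y) // [LHS]big_mkcond.
rewrite [X in _ = X + _]big_mkcond [X in _ = _ + X]big_mkcond -big_split.
apply: eq_bigr => u _ /=.
by have [->|] := eqVneq u x; rewrite ?(negPf xy) ?addr0 ?add0r.
Qed.

Lemma order_GammaE m r : order_Gamma m.+2 r = (r * m + 2)%N.
Proof. by rewrite /order_Gamma; lia. Qed.

Lemma block_vertexP m r w : (0 < m)%N -> (0 < w <= r * m + 2)%N ->
  [\/ w = 1%N, w = 2%N |
    exists k j, [/\ (k < r)%N, (j < m)%N & w = (k * m + 3 + j)%N]].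
Proof.
move=> m0; case: w => [|[|[|w]]] // /andP[_ wN]; [by constructor 1|by constructor 2|].
constructor 3; exists (w %/ m)%N, (w %% m)%N.
split; [rewrite ltn_divLR //; lia | by rewrite ltn_mod |].
by rewrite {1}(divn_eq w m); lia.
Qed.

Lemma block_vertex_range m r k j : (k < r)%N -> (j < m)%N ->
  (0 < k * m + 3 + j <= r * m + 2)%N.
Proof.
move=> kr jm.
have : (k.+1 * m <= r * m)%N by rewrite leq_mul2r kr orbT.
lia.
Qed.

Lemma joint_vertex_range m r k : (0 < m)%N -> (0 < r)%N -> (k <= r.+1)%N ->
  (0 < joint m k <= r * m + 2)%N.
Proof.
move=> m0 r0; case: k => [|[|k]] kr; rewrite /=; try lia.
rewrite -/(joint m k.+2) jointSS.
have : (k.+1 * m <= r * m)%N by rewrite leq_mul2r -ltnS kr orbT.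
lia.
Qed.

(** Each equation has at most two terms besides the eigenvalue term: the edges
    entering a vertex come from its predecessor on the path and, at a joint,
    from the next joint. *)
Lemma eigenvalue_adjacencyP (K : fieldType) m r (a : K) :
  (0 < m)%N -> (0 < r)%N ->
  eigenvalue (adjacency_mx K m.+2 r) a <->
  exists f : nat -> K, (exists2 w, (0 < w <= r * m + 2)%N & f w != 0) /\
   [/\ f (joint m 2) = a * f (joint m 1), f (joint m 1) = a * f (joint m 0) &
    forall k j, (k < r)%N -> (j < m)%N ->
      f (if j == 0%N then joint m k else (k * m + 2 + j)%N)
      + (if (j.+1 == m) && (k.+1 < r)%N then f (joint m k.+3) else 0)
      = a * f (k * m + 3 + j)%N].
Proof.
move=> m0 r0; rewrite /adjacency_mx eigenvalue_relP order_GammaE.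
have sum_to1 (f : nat -> K) :
  \sum_(1 <= u < (r * m + 2).+1 | edges_Gamma m.+2 r u 1) f u = f (joint m 2).
  under eq_bigl do rewrite edges_Gamma_to1 //.
  by rewrite big_nat1_eq ltnS joint_vertex_range.
have sum_to2 (f : nat -> K) :
  \sum_(1 <= u < (r * m + 2).+1 | edges_Gamma m.+2 r u 2) f u = f (joint m 1).
  under eq_bigl do rewrite edges_Gamma_to2 //.
  by rewrite big_nat1_eq addn2.
have sum_to_block (f : nat -> K) k j : (k < r)%N -> (j < m)%N ->
  \sum_(1 <= u < (r * m + 2).+1 | edges_Gamma m.+2 r u (k * m + 3 + j)%N) f u
  = f (if j == 0%N then joint m k else (k * m + 2 + j)%N)
      + (if (j.+1 == m) && (k.+1 < r)%N then f (joint m k.+3) else 0).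
  move=> kr jm; under eq_bigl do rewrite edges_Gamma_to_block // andbA.
  have kE := block_vertex_range kr jm.
  rewrite sum_pred2_nat //.
    case: eqP => j0; [apply: joint_vertex_range => //|]; lia.
  move=> /andP[jm1 k1]; split; first exact: joint_vertex_range.
  have k3 : (k * m + 3 + j < joint m k.+3)%N by rewrite jointSS !mulSn; lia.
  have := joint_lt k m0.
  by case: (j =P 0%N) => j0 kk; lia.
split=> -[f [fN0 fE]]; exists f; split=> //.
  split=> [||k j kr jm].
  - by rewrite -sum_to1 fE // addn2.
  - by rewrite -sum_to2 fE // addn2.
  - by rewrite -sum_to_block // fE // block_vertex_range.
case: fE => f1 f2 fB w /(block_vertexP m0)[->|->|[k [j [kr jm ->]]]].
- by rewrite sum_to1.
- by rewrite sum_to2.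
- by rewrite sum_to_block // fB.
Qed.

Lemma joint_weight_rec (K : fieldType) m (a : K) k : (0 < m)%N -> a != 0 ->
  let Y i := a ^+ i * chain_poly (a ^- m.+2) i in
  Y k.+3 = a * Y k.+2 - a ^- m.-1 * Y k.
Proof.
case: m => // m _ a0 Y; rewrite /Y chain_poly_rec !exprS /=; field.
by rewrite a0 expf_neq0.
Qed.

(** The interior vertices of a block have a single entering edge, so the value
    is divided by [a] at each step away from the joint. *)
Lemma eigenvector_block (K : fieldType) m r (a : K) f : a != 0 ->
  (forall k j, (k < r)%N -> (j < m)%N ->
      f (if j == 0%N then joint m k else (k * m + 2 + j)%N)
      + (if (j.+1 == m) && (k.+1 < r)%N then f (joint m k.+3) else 0)
      = a * f (k * m + 3 + j)%N) ->
  forall k j, (k < r)%N -> (j.+1 < m)%N ->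
    f (k * m + 3 + j)%N = f (joint m k) * a ^- j.+1.
Proof.
move=> a0 fB k j kr; elim: j => [|j IH] jm; apply: (mulfI a0).
  have := fB k 0%N kr (ltnW jm); rewrite (ltn_eqF jm) /= addr0 => <-.
  by rewrite expr1 mulrCA mulfV ?mulr1.
have := fB k j.+1 kr (ltnW jm); rewrite (ltn_eqF jm) /= addr0 => <-.
have -> : (k * m + 2 + j.+1 = k * m + 3 + j)%N by lia.
rewrite IH; last exact: ltnW.
rewrite !exprS; field.
by rewrite a0 expf_neq0.
Qed.

(** An eigenvector is a multiple of [Y k = a ^ k * P_k(a ^- n)] at the joints.
    The equations at the joints give the recurrence for [Y]; at the last joint
    the term from the following joint is absent, and this amounts to
    [Y r.+2 = 0]. *)
Lemma eigenvalue_adjacency (K : fieldType) m r (a : K) :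
  (0 < m)%N -> (0 < r)%N -> a != 0 ->
  eigenvalue (adjacency_mx K m.+2 r) a <-> chain_poly (a ^- m.+2) r.+2 = 0.
Proof.
move=> m0 r0 a0; rewrite eigenvalue_adjacencyP //.
pose Y i := a ^+ i * chain_poly (a ^- m.+2) i.
have Y0 : Y 0%N = 1 by rewrite /Y mulr1.
have Y1 : Y 1%N = a by rewrite /Y mulr1.
have Y2 : Y 2%N = a ^+ 2 by rewrite /Y mulr1.
have YS k : Y k.+3 = a * Y k.+2 - a ^- m.-1 * Y k by exact: joint_weight_rec.
have YE : chain_poly (a ^- m.+2) r.+2 = 0 <-> Y r.+2 = 0.
  rewrite /Y; split=> [->|/eqP]; first by rewrite mulr0.
  by rewrite mulf_eq0 expf_eq0 (negPf a0) andbF => /eqP.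
have lastE k : (k * m + 3 + m.-1 = k.+1 * m + 2)%N by lia.
rewrite YE; split=> [[f [[w wN fw] [f1 f2 fB]]]|Yr].
  have fblock := eigenvector_block a0 fB.
  have fjoint k : (k < r)%N -> f (joint m k) * a ^- m.-1
      + (if (k.+1 < r)%N then f (joint m k.+3) else 0) = a * f (joint m k.+2).
    move=> kr; rewrite [joint m k.+2]jointSS -lastE -fB ?prednK ?eqxx //.
    case: eqP => [->|/eqP m1]; first by rewrite invr1 mulr1.
    have -> : (k * m + 2 + m.-1 = k * m + 3 + m.-2)%N by lia.
    rewrite fblock //; last lia.
    by congr (_ * _ ^- _ + _); lia.
  have fY k : (k <= r.+1)%N -> f (joint m k) = f 2%N * Y k.
    elim/lag3_ind: k => [_|_|_|k IH0 _ IH2 kr].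
    - by rewrite Y0 mulr1.
    - by rewrite Y1 f2 mulrC.
    - by rewrite Y2 f1 f2 /=; ring.
    have k1 : (k.+1 < r)%N by [].
    have := fjoint k (ltnW k1); rewrite k1 IH0 ?IH2 //; try lia.
    rewrite YS => /(canRL (addKr _)) ->; ring.
  (* All values are multiples of the value at vertex 2. *)
  have f2N0 : f 2%N != 0.
    apply: contra fw => /eqP f20.
    have fj k : (k <= r.+1)%N -> f (joint m k) = 0.
      by move=> /fY->; rewrite f20 mul0r.
    case: (block_vertexP m0 wN) => [->|->|[k [j [kr jm ->]]]].
    - by rewrite -[1%N]/(joint m 1) fj.
    - by rewrite f20.
    have [jm1|jm1] := ltnP j.+1 m.
      by rewrite fblock // fj ?mul0r //; lia.
    have -> : (k * m + 3 + j = joint m k.+2)%N by rewrite jointSS; lia.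
    by rewrite fj.
  apply: (mulfI f2N0); rewrite mulr0.
  have := fjoint r.-1; rewrite prednK // ltnn leqnn addr0 !fY; try lia.
  have -> : r.+2 = r.-1.+3 by lia.
  move=> /(_ isT) E; rewrite YS prednK // mulrBr mulrCA -E; ring.
(* Conversely, the values Y at the joints extend along the blocks. *)
pose f w := if w is w'.+3 then
    if (w' %% m)%N.+1 == m then Y (w' %/ m)%N.+2
    else Y (w' %/ m)%N * a ^- (w' %% m)%N.+1
  else if w is 1 then a else 1.
have f_block k j : (j < m)%N -> f (k * m + 3 + j)%N
    = if j.+1 == m then Y k.+2 else Y k * a ^- j.+1.
  move=> jm; have -> : (k * m + 3 + j = (k * m + j).+3)%N by lia.
  by rewrite /f divnMDl // modnMDl modn_small // divn_small // addn0.
have f_joint k : f (joint m k) = Y k.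
  case: k => [|[|k]]; rewrite ?Y0 ?Y1 //.
  by rewrite jointSS -lastE f_block prednK ?eqxx.
exists f; split; first by exists 2%N; rewrite ?addn2 // oner_eq0.
split; rewrite ?f_joint ?Y0 ?Y1 ?Y2 ?mulr1 // => k j kr jm.
rewrite f_block // f_joint.
have -> : f (if j == 0%N then joint m k else (k * m + 2 + j)%N) = Y k * a ^- j.
  case: j jm => [|j] jm /=; first by rewrite f_joint invr1 mulr1.
  have -> : (k * m + 2 + j.+1 = k * m + 3 + j)%N by lia.
  by rewrite f_block ?ltn_eqF // ltnW.
have [jm1|_] := eqVneq j.+1 m; last first.
  rewrite addr0 !exprS; field.
  by rewrite a0 expf_neq0.
have jE : j = m.-1 by lia.
have [k1|k1] := ltnP k.+1 r; first by rewrite /= YS jE; ring.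
have kE : k.+3 = r.+2 by lia.
have := YS k; rewrite kE Yr jE => /esym/eqP; rewrite subr_eq0 => /eqP->.
by rewrite /= addr0 mulrC.
Qed.

(** * Rational eigenvalues *)

Unset Implicit Arguments.
Local Open Scope classical_set_scope.

Theorem theorem7p3 (R : realType) (n r : nat) (hn : (3 <= n)%N) (hr : (1 <= r)%N) :
  (Spec (adjacency_mx R[i] n r) `&` nonzero_rationals R[i] !=set0
     <-> Spec (adjacency_mx R[i] n r) 1)
  /\ (Spec (adjacency_mx R[i] n r) 1 <-> r = 1%N \/ r = 10%N).
Proof.
case: n hn => [|[|m]] // hn; have m0 : (0 < m)%N by [].
have spec1 : Spec (adjacency_mx R[i] m.+2 r) 1 <-> chain_poly (1 : R[i]) r.+2 = 0.
  by rewrite /Spec /= eigenvalue_adjacency ?oner_eq0 // expr1n invr1.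
split.
  split=> [[x [/= x_eig [q /= q0 qx]]]|eig1]; last first.
    by exists 1; split=> //; exists 1; rewrite ?rmorph1 /= ?oner_eq0.
  apply/spec1; move: x_eig; rewrite /Spec /= -qx eigenvalue_adjacency ?fmorph_eq0 //.
  rewrite -rmorphXn -fmorphV.
  have ratrE (t : rat) : chain_poly (ratr t : R[i]) r.+2
      = ratr (chain_poly t r.+2).
    by rewrite /chain_poly lag3_rmorph !rmorph1.
  rewrite ratrE => /eqP; rewrite fmorph_eq0 => /eqP rootq.
  have qn1 := rat_root_chain_poly q0 hn rootq.
  by rewrite qn1 invr1 in rootq;
    rewrite -(rmorph1 (@ratr R[i])) ratrE rootq rmorph0.
rewrite spec1.
have -> : chain_poly (1 : R[i]) r.+2 = (chain_poly (1 : int) r.+2)%:~R.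
  by rewrite /chain_poly lag3_rmorph !rmorph1.
split=> [/eqP|r110].
  by rewrite intr_eq0 chain_poly1_eq0 // => /orP[]/eqP[->]; [left|right].
by apply/eqP; rewrite intr_eq0 chain_poly1_eq0 //; case: r110 => ->.
Qed.
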